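(* Let $\{S_t : t\in\mathbb{R}^+\}$ be the observed process of a continuous-time three-state hidden Markov model with transition rate matrix $Q$, stationary distribution $\mu=(\mu_1,\mu_2,\mu_3)$ and state-dependent probability matrix $\Pi$ with columns $\varphi_0,\dots,\varphi_{K-1}$. Let $-\lambda_1,-\lambda_2$ be the nonzero eigenvalues of $Q$ and $\nu=\mu_1a_2-\mu_2b_1$ the transition rate flux. Then for every observed state $i\in\{0,\dots,K-1\}$ and all $r,t>0$, $$\Pr\{S_0=S_r=S_{r+t}=i\}-\Pr\{S_0=S_t=S_{t+r}=i\}=\frac{\nu D}{\lambda_1-\lambda_2}\left(e^{-\lambda_2 r-\lambda_1 t}-e^{-\lambda_2 t-\lambda_1 r}\right),$$ where $D=(x-y)(y-z)(z-x)$ and $(x,y,z)'=\varphi_i$.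
   Context: Continuous-time three-state hidden Markov model: $\{C_t:t\in\mathbb{R}^+\}$ is an irreducible, time-homogeneous Markov process on the three states $\{1,2,3\}$ with transition rate matrix $$Q=\begin{pmatrix}-a_1&a_2&a_3\\ b_1&-b_2&b_3\\ c_1&c_2&-c_3\end{pmatrix},\quad a_1=a_2+a_3,\ b_2=b_1+b_3,\ c_3=c_1+c_2,\quad a_i,b_i,c_i\ge 0,$$ started from its stationary distribution $\mu=(\mu_1,\mu_2,\mu_3)$, $\mu_i>0$, $\sum_i\mu_i=1$. By stationarity $\mu_1a_2-\mu_2b_1=\mu_2b_3-\mu_3c_2=\mu_3c_1-\mu_1a_3$; this common value is the transition rate flux $\nu$. The state-dependent probability matrix $\Pi=(\pi(k\,|\,i))$, $i=1,2,3$, $k=0,\dots,K-1$, is a $3\times K$ matrix with nonnegative entries and rows summing to 1; $\varphi_k\in\mathbb{R}^3$ is its column indexed by $k$ and a prime denotes transpose. The observed process $\{S_t\}$ takes values in $\{0,\dots,K-1\}$; conditionally on the hidden state at time $t$, $S_t$ has law $\pi(\cdot\,|\,C_t)$ and is independent of all earlier observations and of the hidden process before time $t$. Thus for $0\le t_1<\cdots<t_n$, $\Pr(S_{t_1}=s_1,\dots,S_{t_n}=s_n)=\mu\Lambda_{s_1}P(t_2-t_1)\Lambda_{s_2}\cdots P(t_n-t_{n-1})\Lambda_{s_n}\vec e$, where $P(t)=e^{tQ}$, $\Lambda_k=\mathrm{diag}(\varphi_k)$, $\vec e=(1,1,1)'$. The eigenvalues of $Q$ are $0,-\lambda_1,-\lambda_2$,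 where $\lambda_1,\lambda_2$ are nonzero and possibly complex. When $\lambda_1=\lambda_2$, formulas containing $\frac{1}{\lambda_1-\lambda_2}$ are read as limits $\lambda_2\to\lambda_1$ (so $\frac{e^{-\lambda_2r-\lambda_1t}-e^{-\lambda_2t-\lambda_1r}}{\lambda_1-\lambda_2}$ means $(r-t)e^{-\lambda_1(r+t)}$). *)

(* Defs.v *)
From HB Require Import structures.
From mathcomp Require Import all_boot all_order all_algebra.
From mathcomp Require Import all_classical all_reals all_analysis.
From mathcomp Require Import complex.

Set Implicit Arguments.
Unset Strict Implicit.
Unset Printing Implicit Defensive.

Import Order.TTheory GRing.Theory Num.Theory.
Import numFieldNormedType.Exports.

Local Open Scope classical_set_scope.
Local Open Scope complex_scope.
Local Open Scope ring_scope.

(* The hidden states 1, 2, 3 are the elements 0, 1, 2 of 'I_3, so that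
   a_2 = Q 0 1, b_1 = Q 1 0, etc.  Distributions are row vectors. *)

Definition expmx (R : realType) (n : nat) (A : 'M[R]_n.+1) : 'M[R]_n.+1 :=
  limn (series (fun k : nat => (k`!%:R)^-1 *: A ^+ k)).

Definition transition (R : realType) (Q : 'M[R]_3) (t : R) : 'M[R]_3 :=
  expmx (t *: Q).

Definition rate_matrix (R : realType) (Q : 'M[R]_3) : Prop :=
  (forall i j, i != j -> 0 <= Q i j) /\ (forall i, \sum_j Q i j = 0).

Definition irreducible_rates (R : realType) (Q : 'M[R]_3) : Prop :=
  forall i j, exists2 t : R, 0 < t & 0 < transition Q t i j.

Definition stationary (R : realType) (Q : 'M[R]_3) (mu : 'rV[R]_3) : Prop :=
  [/\ forall i, 0 < mu 0 i, \sum_i mu 0 i = 1 &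
      forall t : R, 0 <= t -> mu *m transition Q t = mu].

Definition stochastic (R : realType) (m n : nat) (A : 'M[R]_(m, n)) : Prop :=
  (forall i k, 0 <= A i k) /\ (forall i, \sum_k A i k = 1).

Definition times_upto (R : realType) (tau : nat -> R) (n : nat) : Prop :=
  0 <= tau 0%N /\ forall k, (k < n)%N -> tau k < tau k.+1.

Definition history (R : realType) (T : Type) (K : nat)
    (C : R -> T -> 'I_3) (S : R -> T -> 'I_K)
    (tau : nat -> R) (x : nat -> 'I_3) (s : nat -> 'I_K) (n : nat) : set T :=
  [set w | forall k, (k < n)%N -> C (tau k) w = x k /\ S (tau k) w = s k].

(* Hidden Markov model started from stationarity.  The processes are only
   constrained at times t >= 0.  Conditional probabilities are stated in product
   form, so that null conditioning events need no special treatment.  The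
   hidden process is Markov with respect to the joint history of hidden and
   observed states: together with the emission clause this is what yields
   mu Lambda_{s_1} P(t_2 - t_1) Lambda_{s_2} ... Lambda_{s_n} e for the law of
   the observations. *)
Record hidden_markov_model (R : realType) (d : measure_display)
    (T : measurableType d) (P : probability T R) (K : nat)
    (C : R -> T -> 'I_3) (S : R -> T -> 'I_K)
    (Q : 'M[R]_3) (mu : 'rV[R]_3) (Pi : 'M[R]_(3, K)) : Prop := {
  hmm_rate : rate_matrix Q;
  hmm_irreducible : irreducible_rates Q;
  hmm_stationary : stationary Q mu;
  hmm_stochastic : stochastic Pi;
  hmm_measurable_hidden : forall (t : R) (j : 'I_3), 0 <= t ->
    measurable [set w | C t w = j];
  hmm_measurable_observed : forall (t : R) (k : 'I_K), 0 <= t ->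
    measurable [set w | S t w = k];
  hmm_initial : forall j : 'I_3, P [set w | C 0 w = j] = (mu 0 j)%:E;
  hmm_markov : forall tau x s n, times_upto tau n.+1 ->
    P (history C S tau x s n.+1 `&` [set w | C (tau n.+1) w = x n.+1]) =
    (P (history C S tau x s n.+1) *
     (transition Q (tau n.+1 - tau n) (x n) (x n.+1))%:E)%E;
  hmm_emission : forall tau x s n, times_upto tau n ->
    P (history C S tau x s n `&`
       [set w | C (tau n) w = x n /\ S (tau n) w = s n]) =
    (P (history C S tau x s n `&` [set w | C (tau n) w = x n]) *
     (Pi (x n) (s n))%:E)%E
}.

Definition expC (R : realType) (z : R[i]) : R[i] :=
  (expR (complex.Re z) * cos (complex.Im z)) +i*
  (expR (complex.Re z) * sin (complex.Im z)).

(* For l1 = l2 the quotient is read as its limit as l2 tends to l1. *)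
Definition exp_quotient (R : realType) (l1 l2 : R[i]) (r t : R) : R[i] :=
  if l1 == l2 then (r - t)%:C * expC (- l1 * (r + t)%:C)
  else (expC (- l2 * r%:C - l1 * t%:C) - expC (- l2 * t%:C - l1 * r%:C))
       / (l1 - l2).

(* Eigenvalues 0, -l1, -l2 are counted with algebraic multiplicity. *)
Definition nonzero_eigenvalues (R : realType) (Q : 'M[R]_3) (l1 l2 : R[i]) :
    Prop :=
  [/\ l1 != 0, l2 != 0 &
      char_poly (map_mx (real_complex R) Q) =
      \prod_(l <- [:: 0; - l1; - l2]) ('X - l%:P)].

Definition flux (R : realType) (Q : 'M[R]_3) (mu : 'rV[R]_3) : R :=
  mu 0 0 * Q 0 1 - mu 0 1 * Q 1 0.

(* Main.v *)
Require Import Defs.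
From HB Require Import structures.
From mathcomp Require Import all_boot all_order all_algebra.
From mathcomp Require Import all_classical all_reals all_analysis.
From mathcomp Require Import complex.
From mathcomp Require Import ring.

Import Order.TTheory GRing.Theory Num.Theory.
Import numFieldNormedType.Exports.

Set Implicit Arguments.
Unset Strict Implicit.

Local Open Scope classical_set_scope.
Local Open Scope complex_scope.
Local Open Scope ring_scope.

(** Writing phi for the column of the observed symbol, L for diag(phi) and e for
    the all-ones column, the probability of seeing the symbol at 0, r and r + t
    is B(P(r), P(t)), where B(M, N) = mu L M L N L e.  So the left-hand side of
    the theorem is the antisymmetric part of the bilinear form B, taken at
    P(r), P(t).

    Two facts make this antisymmetric part one-dimensional.  The rank-one
    matrix E = e mu is invisible to it: B(E, N) and
    B(N, E) are both the product of mu phi with mu L N phi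
    (joint3_stationaryC).  And every P(t) lies in the span of E, 1 - E and Q,
    because Q satisfies a quadratic relation modulo E: Q^2 + (l1 + l2) Q + l1 l2
    is the adjugate of Q, all rows of which are proportional to mu
    (stationary_projection).  Hence, if P(t) = E + a(t) (1 - E) + b(t) Q, only
    the pair (1, Q) contributes (joint3_asym).  The quantity
    B(1, Q) - B(Q, 1) is a sum of mu_i Q_ij phi_i phi_j (phi_i - phi_j), in
    which the net current between each pair of states is the same flux up to
    orientation, so that D factors out (joint3_generator).

    It remains to find the Wronskian-like expression b(r) a(t) - a(r) b(t),
    which is the quotient of exponentials (flow_decomposition).  The
    coefficients a and b come from the differential equation P' = Q P: the
    matrix (Q + l2) P(t) - l2 E satisfies Y' = - l1 Y, likewise with l1 and l2
    exchanged, and the two solutions determine P(t), directly if l1 and l2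
    differ and after one more integration if they coincide. *)

(** * The matrix exponential *)

Lemma cvg_mx (R : realType) (m n : nat) (u : nat -> 'M[R]_(m, n))
    (L : 'M[R]_(m, n)) :
  (forall i j, (fun k => u k i j) @ \oo --> L i j) -> u @ \oo --> L.
Proof.
move=> uL; apply/cvg_ballP => e e0.
have /filter_forall near_uL : forall ij : 'I_m * 'I_n,
    \forall k \near \oo, ball (L ij.1 ij.2) e (u k ij.1 ij.2).
  by move=> [i j]; have /cvg_ballP := uL i j; exact.
apply: filterS near_uL => k kP; split=> // i j.
exact: (kP (i, j)).
Qed.

(** Submultiplicativity of the entrywise l1 norm, in the weak form that
    dominates the exponential series of a matrix by a scalar one. *)
Lemma ler_norm_mxX (R : realType) (n : nat) (A : 'M[R]_n.+1) (k : nat)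
    (i j : 'I_n.+1) :
  `|(A ^+ k) i j| <= (\sum_i \sum_j `|A i j|) ^+ k.
Proof.
set c := \sum_i _; have c_ge0 : 0 <= c.
  by apply: sumr_ge0 => p _; apply: sumr_ge0.
elim: k i j => [|k IHk] i j.
  by rewrite !expr0 mxE; case: (i == j); rewrite ?normr1 ?normr0.
rewrite exprSr -mulmxE mxE (le_trans (ler_norm_sum _ _ _))//.
rewrite exprSr mulr_sumr; apply: ler_sum => l _.
rewrite normrM ler_pM//.
by rewrite (bigD1 j)//= lerDl sumr_ge0.
Qed.

Definition expmx_coef (R : realType) (n : nat) (A : 'M[R]_n.+1)
    (i j : 'I_n.+1) (k : nat) : R := (k`!%:R)^-1 * (A ^+ k) i j.

Lemma is_cvg_expmx_coef (R : realType) (n : nat) (A : 'M[R]_n.+1)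
    (i j : 'I_n.+1) (t : R) : cvgn (pseries (expmx_coef A i j) t).
Proof.
set c := \sum_i \sum_j `|A i j|.
have c_ge0 : 0 <= c by apply: sumr_ge0 => p _; apply: sumr_ge0.
apply: normed_cvg; rewrite /normed_series_of /=.
apply: (@series_le_cvg _ _ (exp_coeff (c * `|t|))) => //.
- by move=> k; apply: exp_coeff_ge0; rewrite mulr_ge0.
- move=> k; rewrite /exp_coeff /= /expmx_coef !normrM normrX exprMn.
  rewrite normfV normr_nat.
  rewrite -mulrA [leRHS]mulrC ler_wpM2l ?invr_ge0// ler_wpM2r ?exprn_ge0//.
  exact: ler_norm_mxX.
- exact: is_cvg_series_exp_coeff.
Qed.

Lemma expmxE (R : realType) (n : nat) (A : 'M[R]_n.+1) (t : R)
    (i j : 'I_n.+1) :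
  expmx (t *: A) i j = limn (pseries (expmx_coef A i j) t).
Proof.
pose L := \matrix_(i, j) limn (pseries (expmx_coef A i j) t).
rewrite /expmx (_ : limn _ = L) ?mxE//.
apply/cvg_lim => //; apply: cvg_mx => p q.
rewrite mxE (_ : (fun k => _) = pseries (expmx_coef A p q) t).
  exact: is_cvg_expmx_coef.
apply/funext => k; rewrite /pseries /series /= summxE.
apply: eq_bigr => l _; rewrite exprZn !mxE /expmx_coef.
by rewrite [RHS]mulrAC mulrA.
Qed.

Lemma expmx0 (R : realType) (n : nat) (A : 'M[R]_n.+1) : expmx (0 *: A) = 1.
Proof.
apply/matrixP => i j; rewrite expmxE; apply/cvg_lim => //.
apply/cvgrPdist_lt => e e0; near=> k.
have -> : k = k.-1.+1 by rewrite prednK//; near: k; exists 1%N.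
rewrite /pseries /series /= big_nat_recl//= big1 => [|l _].
  by rewrite addr0 expr0 mulr1 /expmx_coef fact0 invr1 mul1r expr0 subrr normr0.
by rewrite expr0n /= mulr0.
Unshelve. all: by end_near. Qed.

(** Termwise differentiation turns the coefficient of order k of exp(tA) into
    that of A exp(tA): the factor A is split off on the left of the power of
    order k + 1. *)
Lemma is_derive_expmx (R : realType) (n : nat) (A : 'M[R]_n.+1) (t : R)
    (i j : 'I_n.+1) :
  is_derive t 1 (fun s => expmx (s *: A) i j) ((A *m expmx (t *: A)) i j).
Proof.
have diffsE p q : pseries_diffs (expmx_coef A p q) =
    fun k => \sum_l A p l * expmx_coef A l q k.
  apply/funext => k; rewrite /pseries_diffs /expmx_coef factS natrM invfM.
  rewrite mulrA mulVKf ?pnatr_eq0// exprS -mulmxE mxE mulr_sumr.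
  by apply: eq_bigr => l _; rewrite mulrCA.
have cvg_comb (B : 'M[R]_n.+1) p q s :
    pseries (fun k => \sum_l B p l * expmx_coef A l q k) s @ \oo -->
    (B *m expmx (s *: A)) p q.
  rewrite mxE.
  rewrite (_ : pseries _ s =
      (fun k => \sum_l B p l * pseries (expmx_coef A l q) s k)); last first.
    apply/funext => k; rewrite /pseries /series /=.
    under eq_bigr do rewrite mulr_suml.
    rewrite exchange_big; apply: eq_bigr => l _ /=.
    by rewrite mulr_sumr; apply: eq_bigr => m _; rewrite mulrA.
  rewrite -(@fct_sumE _ _ _ _ _
    (fun l k => B p l * pseries (expmx_coef A l q) s k)).
  elim/big_ind2: _ => [|f x g y|l _]; [exact: cvg_cst | exact: cvgD |].
  apply: cvgM; first exact: cvg_cst.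
  by rewrite expmxE; exact: is_cvg_expmx_coef.
have diffs2E p q : pseries_diffs (pseries_diffs (expmx_coef A p q)) =
    fun k => \sum_l (A *m A) p l * expmx_coef A l q k.
  rewrite diffsE; apply/funext => k; rewrite /pseries_diffs mulr_sumr.
  under eq_bigr => l _.
    rewrite mulrCA -/(pseries_diffs _ _) diffsE mulr_sumr.
    over.
  rewrite exchange_big; apply: eq_bigr => l _ /=.
  by rewrite mxE mulr_suml; apply: eq_bigr => m _; rewrite mulrA.
have -> : (fun s => expmx (s *: A) i j) =
    (fun s => limn (pseries (expmx_coef A i j) s)).
  by apply/funext => s; rewrite expmxE.
have <- : limn (pseries (pseries_diffs (expmx_coef A i j)) t) =
    (A *m expmx (t *: A)) i j.
  by apply/cvg_lim => //; rewrite diffsE; exact: cvg_comb.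
apply: (@pseries_snd_diffs _ _ (`|t| + 1)).
- exact: is_cvg_expmx_coef.
- by rewrite diffsE; apply/cvg_ex; eexists; exact: cvg_comb.
- by rewrite diffs2E; apply/cvg_ex; eexists; exact: cvg_comb.
- by rewrite [ltRHS]ger0_norm ?addr_ge0// ltrDl.
Qed.


(** * Complex-valued functions of a real variable *)

(** The derivative is taken on real and imaginary parts separately, so that
    a function with zero derivative is constant by the real mean value
    theorem applied to each part. *)
Definition is_cderive (R : realType) (f : R -> R[i]) (t : R) (df : R[i]) :
    Prop :=
  is_derive t 1 (fun s => complex.Re (f s)) (complex.Re df) /\
  is_derive t 1 (fun s => complex.Im (f s)) (complex.Im df).

Lemma is_cderive_real (R : realType) (f : R -> R) (t df : R) :
  is_derive t 1 f df -> is_cderive (fun s => (f s)%:C) t df%:C.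
Proof. by move=> fd; split=> //=; exact: is_derive_cst. Qed.

Lemma is_cderive_cst (R : realType) (a : R[i]) (t : R) :
  is_cderive (fun=> a) t 0.
Proof. by split; exact: is_derive_cst. Qed.

Lemma is_cderiveD (R : realType) (f g : R -> R[i]) (t : R) (df dg : R[i]) :
  is_cderive f t df -> is_cderive g t dg ->
  is_cderive (fun s => f s + g s) t (df + dg).
Proof.
have ReD (x y : R[i]) : complex.Re (x + y) = complex.Re x + complex.Re y.
  by case: x y => [? ?] [? ?].
have ImD (x y : R[i]) : complex.Im (x + y) = complex.Im x + complex.Im y.
  by case: x y => [? ?] [? ?].
move=> [fr fi] [gr gi]; split; rewrite ?ReD ?ImD.
  by under eq_fun do rewrite ReD; exact: is_deriveD.
by under eq_fun do rewrite ImD; exact: is_deriveD.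
Qed.

Lemma is_cderiveM (R : realType) (f g : R -> R[i]) (t : R) (df dg : R[i]) :
  is_cderive f t df -> is_cderive g t dg ->
  is_cderive (fun s => f s * g s) t (df * g t + f t * dg).
Proof.
have ReM (x y : R[i]) : complex.Re (x * y) =
    complex.Re x * complex.Re y - complex.Im x * complex.Im y.
  by case: x y => [? ?] [? ?].
have ImM (x y : R[i]) : complex.Im (x * y) =
    complex.Re x * complex.Im y + complex.Im x * complex.Re y.
  by case: x y => [? ?] [? ?].
move=> [fr fi] [gr gi]; split.
  under eq_fun do rewrite ReM.
  apply: (is_derive_eq (is_deriveB (is_deriveM fr gr) (is_deriveM fi gi))).
  case: (f t) (g t) df dg {fr fi gr gi} => [a b] [c d] [a' b'] [c' d'] /=.
  by rewrite /GRing.scale /=; ring.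
under eq_fun do rewrite ImM.
apply: (is_derive_eq (is_deriveD (is_deriveM fr gi) (is_deriveM fi gr))).
case: (f t) (g t) df dg {fr fi gr gi} => [a b] [c d] [a' b'] [c' d'] /=.
by rewrite /GRing.scale /=; ring.
Qed.

Lemma is_cderive_eq (R : realType) (f : R -> R[i]) (t : R) (df dg : R[i]) :
  is_cderive f t df -> df = dg -> is_cderive f t dg.
Proof. by move=> ? <-. Qed.

Lemma is_cderiveZ (R : realType) (a : R[i]) (f : R -> R[i]) (t : R)
    (df : R[i]) :
  is_cderive f t df -> is_cderive (fun s => a * f s) t (a * df).
Proof.
move=> fd; apply: is_cderive_eq (is_cderiveM (is_cderive_cst a t) fd) _.
by rewrite mul0r add0r.
Qed.

Lemma is_cderive_sum (R : realType) (n : nat) (f : 'I_n -> R -> R[i]) (t : R)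
    (df : 'I_n -> R[i]) :
  (forall i, is_cderive (f i) t (df i)) ->
  is_cderive (fun s => \sum_i f i s) t (\sum_i df i).
Proof.
move=> fd; rewrite -fct_sumE; elim/big_ind2: _ => //.
  exact: is_cderive_cst.
by move=> *; exact: is_cderiveD.
Qed.

Lemma is_cderive_0_cst (R : realType) (f : R -> R[i]) (s t : R) :
  (forall u, is_cderive f u 0) -> f s = f t.
Proof.
move=> f0; apply/eqP; rewrite eq_complex; apply/andP; split; apply/eqP.
  apply: (@is_derive_0_is_cst _ (fun u => complex.Re (f u))) => u.
  by case: (f0 u).
apply: (@is_derive_0_is_cst _ (fun u => complex.Im (f u))) => u.
by case: (f0 u).
Qed.

Lemma expCD (R : realType) (z w : R[i]) : expC (z + w) = expC z * expC w.
Proof.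
case: z w => [a b] [c d]; rewrite /expC /= expRD cosD sinD.
by apply/eqP; rewrite eq_complex /=; apply/andP; split; apply/eqP; ring.
Qed.

Lemma expC0 (R : realType) : expC (0 : R[i]) = 1.
Proof. by rewrite /expC /= expR0 cos0 sin0 mulr1 mulr0. Qed.

Lemma is_cderive_expC (R : realType) (a : R[i]) (t : R) :
  is_cderive (fun s => expC (a * s%:C)) t (a * expC (a * t%:C)).
Proof.
case: a => x y.
have linE (s : R) : (x +i* y) * s%:C = (x * s) +i* (y * s).
  by apply/eqP; rewrite eq_complex /= !mulr0 subr0 add0r !eqxx.
have lin (z : R) : is_derive t 1 (fun s => z * s) z.
  apply: (is_derive_eq (is_deriveZ z (is_derive_id t 1))).
  by rewrite /GRing.scale /= mulr1.
have comp (f : R -> R) z df : is_derive (z * t) 1 f df ->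
    is_derive t 1 (fun s => f (z * s)) (df * z).
  by move=> fd; exact: is_derive1_comp.
rewrite /is_cderive linE; under eq_fun do rewrite linE.
under [X in _ /\ is_derive _ _ X _]eq_fun do rewrite linE.
rewrite /expC /=; split.
  apply: (is_derive_eq (is_deriveM (comp _ _ _ (is_derive_expR _))
                                   (comp _ _ _ (is_derive_cos _)))).
  by rewrite /GRing.scale /=; ring.
apply: (is_derive_eq (is_deriveM (comp _ _ _ (is_derive_expR _))
                                 (comp _ _ _ (is_derive_sin _)))).
by rewrite /GRing.scale /=; ring.
Qed.

(** The product of h with exp(- a s) has zero derivative, so it keeps its
    value at 0. *)
Lemma linear_ode (R : realType) (a : R[i]) (h : R -> R[i]) (t : R) :
  (forall s, is_cderive h s (a * h s)) -> h t = h 0 * expC (a * t%:C).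
Proof.
move=> hd.
have -> : h 0 = h t * expC (- a * t%:C).
  have /(@is_cderive_0_cst _ _ 0 t) :
      forall s, is_cderive (fun s => h s * expC (- a * s%:C)) s 0.
    move=> s; apply: is_cderive_eq (is_cderiveM (hd s) (is_cderive_expC _ s)) _.
    by ring.
  by rewrite mulr0 expC0 mulr1.
by rewrite -mulrA -expCD mulNr addNr expC0 mulr1.
Qed.

(** * Stationary distributions and generators *)

(** The function mu exp(sQ) is differentiable at 0 with derivative mu Q, and
    invariance for nonnegative times makes its right difference quotients at 0
    vanish. *)
Lemma stationary_generator (R : realType) (n : nat) (Q : 'M[R]_n.+1)
    (mu : 'rV[R]_n.+1) :
  (forall t, 0 <= t -> mu *m expmx (t *: Q) = mu) -> mu *m Q = 0.
Proof.
move=> mu_inv; apply/rowP => j; rewrite mxE [RHS]mxE.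
pose f (s : R) := \sum_i mu 0 i * expmx (s *: Q) i j.
have fd : is_derive (0 : R) 1 f (\sum_i mu 0 i * Q i j).
  rewrite /f -(@fct_sumE _ _ _ _ _ (fun i s => mu 0 i * expmx (s *: Q) i j)).
  apply: is_derive_sum => i.
  apply: (is_derive_eq (is_deriveZ (mu 0 i) (is_derive_expmx Q 0 i j))).
  by rewrite expmx0 mulmx1.
have f_cst s : 0 <= s -> f s = mu 0 j.
  by move=> s0; rewrite -[in RHS](mu_inv s s0) mxE.
have [fl <-] := fd.
have /cvg_dnbhs_at_right fl_right := fl.
apply: (@cvg_unique _ _ _ _ _ _ fl_right) => //.
apply: (@cvg_near_cst); near=> h.
by rewrite /= scaler1 addr0 f_cst ?f_cst ?subrr ?scaler0.
Unshelve. all: by end_near. Qed.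

Lemma stationary_expmx (R : realType) (n : nat) (Q : 'M[R]_n.+1)
    (mu : 'rV[R]_n.+1) (t : R) :
  mu *m Q = 0 -> mu *m expmx (t *: Q) = mu.
Proof.
move=> muQ; apply/rowP => j; rewrite mxE.
transitivity (\sum_i mu 0 i * expmx (0 *: Q) i j); last first.
  by rewrite expmx0 -[in RHS](mulmx1 mu) mxE.
pose f (s : R) := \sum_i mu 0 i * expmx (s *: Q) i j.
apply: (@is_derive_0_is_cst _ f) => s.
rewrite /f -(@fct_sumE _ _ _ _ _ (fun i s => mu 0 i * expmx (s *: Q) i j)).
have -> : 0 = \sum_i mu 0 i * (Q *m expmx (s *: Q)) i j.
  have /rowP/(_ j) : mu *m (Q *m expmx (s *: Q)) = 0.
    by rewrite mulmxA muQ mul0mx.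
  by rewrite mxE [RHS]mxE.
apply: is_derive_sum => i.
exact: (is_derive_eq (is_deriveZ _ (is_derive_expmx _ _ _ _))).
Qed.

(** * Three-by-three generators *)

Lemma sum3E (V : nmodType) (f : 'I_3 -> V) : \sum_i f i = f 0 + f 1 + f 2.
Proof.
rewrite !big_ord_recl big_ord0 addr0 addrA.
by congr (f _ + f _ + f _); apply/val_inj.
Qed.

Lemma ord3P (P : 'I_3 -> Prop) : P 0 -> P 1 -> P 2 -> forall i, P i.
Proof.
move=> P0 P1 P2 [[|[|[|//]]] Hi].
- by rewrite (_ : Ordinal Hi = 0)//; apply/val_inj.
- by rewrite (_ : Ordinal Hi = 1)//; apply/val_inj.
- by rewrite (_ : Ordinal Hi = 2)//; apply/val_inj.
Qed.

Lemma det3E (F : comNzRingType) (A : 'M[F]_3) :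
  \det A = A 0 0 * (A 1 1 * A 2 2 - A 1 2 * A 2 1)
         - A 0 1 * (A 1 0 * A 2 2 - A 1 2 * A 2 0)
         + A 0 2 * (A 1 0 * A 2 1 - A 1 1 * A 2 0).
Proof.
have det2E (B : 'M[F]_2) : \det B = B 0 0 * B 1 1 - B 0 1 * B 1 0.
  rewrite (expand_det_row _ 0) !big_ord_recl big_ord0 /cofactor !det_mx11 !mxE.
  have -> : lift 0 0 = 1 :> 'I_2 by apply/val_inj.
  have -> : lift 1 0 = 0 :> 'I_2 by apply/val_inj.
  by rewrite /= expr0 expr1; ring.
rewrite (expand_det_row _ 0) sum3E /cofactor !det2E !mxE.
have -> : lift 0 0 = 1 :> 'I_3 by apply/val_inj.
have -> : lift 0 1 = 2 :> 'I_3 by apply/val_inj.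
have -> : lift 1 0 = 0 :> 'I_3 by apply/val_inj.
have -> : lift 1 1 = 2 :> 'I_3 by apply/val_inj.
have -> : lift 2 0 = 0 :> 'I_3 by apply/val_inj.
have -> : lift 2 1 = 1 :> 'I_3 by apply/val_inj.
rewrite /= add0n expr0 expr1 (_ : (-1) ^+ (0 + 2)%N = 1)//.
  by ring.
by rewrite sqrrN expr1n.
Qed.

Lemma horner_char_poly (F : comNzRingType) (n : nat) (A : 'M[F]_n) (x : F) :
  (char_poly A).[x] = \det (x%:M - A).
Proof.
rewrite /char_poly -horner_evalE -det_map_mx; congr (\det _).
apply/matrixP => i j; rewrite !mxE /=.
by rewrite horner_evalE hornerD hornerN hornerC hornerMn hornerX.
Qed.

Definition principal_minors2 (F : comNzRingType) (A : 'M[F]_3) : F :=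
  A 0 0 * A 1 1 - A 0 1 * A 1 0 + (A 1 1 * A 2 2 - A 1 2 * A 2 1)
  + (A 0 0 * A 2 2 - A 0 2 * A 2 0).

(** The coefficients of the characteristic polynomial are read off from its
    values det(x - A) at x = 0, 1, -1. *)
Lemma eigenvalues_sum_prod (F : numFieldType) (A : 'M[F]_3) (l1 l2 : F) :
  char_poly A = \prod_(l <- [:: 0; - l1; - l2]) ('X - l%:P) ->
  l1 + l2 = - (A 0 0 + A 1 1 + A 2 2) /\ l1 * l2 = principal_minors2 A.
Proof.
rewrite !big_cons big_nil mulr1 => charA.
have detE x : \det (x%:M - A) = x * ((x + l1) * (x + l2)).
  by rewrite -horner_char_poly charA !hornerE subr0 !opprK.
have two_neq0 : (2 : F) != 0 by rewrite pnatr_eq0.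
split; apply: (mulfI two_neq0).
  transitivity (\det (1%:M - A) + \det ((- 1)%:M - A) - 2 * \det (0%:M - A)).
    by rewrite !detE; ring.
  by rewrite !det3E !mxE /= !mulr0n !mulr1n; ring.
transitivity (\det (1%:M - A) - \det ((- 1)%:M - A) - 2).
  by rewrite !detE; ring.
by rewrite !det3E !mxE /= !mulr0n !mulr1n /principal_minors2; ring.
Qed.

(** The left-hand side is the adjugate of A.  Since the rows of A sum to zero,
    the adjugate has equal rows (the spanning-tree weights of the three
    states), and multiplying it by mu on the left identifies this common row. *)
Lemma stationary_projection (F : comNzRingType) (A : 'M[F]_3) (mu : 'rV[F]_3) :
  (forall i, \sum_j A i j = 0) -> \sum_i mu 0 i = 1 -> mu *m A = 0 ->
  A *m A - (A 0 0 + A 1 1 + A 2 2) *: A + (principal_minors2 A)%:M =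
  principal_minors2 A *: (const_mx 1 *m mu : 'M[F]_3).
Proof.
move=> row0 mu1 muA.
pose M := A *m A - (A 0 0 + A 1 1 + A 2 2) *: A + (principal_minors2 A)%:M.
have a0 : A 0 0 = - (A 0 1 + A 0 2).
  by apply/eqP; rewrite -addr_eq0 addrA -sum3E row0.
have a1 : A 1 1 = - (A 1 0 + A 1 2).
  by apply/eqP; rewrite -addr_eq0 addrCA addrA -sum3E row0.
have a2 : A 2 2 = - (A 2 0 + A 2 1).
  by apply/eqP; rewrite -addr_eq0 addrC -sum3E row0.
have M_row : forall i j, M i j = M 0 j.
  apply: ord3P => [//||]; apply: ord3P;
    rewrite !mxE !sum3E /= ?mulr0n ?mulr1n /principal_minors2 a0 a1 a2; ring.
have muM : mu *m M = principal_minors2 A *: mu.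
  rewrite /M mulmxDr mulmxBr mulmxA -scalemxAr muA mul0mx scaler0 subr0 add0r.
  by rewrite mul_mx_scalar.
rewrite -/M; clearbody M; apply/matrixP => i j; rewrite M_row.
have /rowP/(_ j) := muM; rewrite !mxE => muMj.
rewrite big_ord_recl big_ord0 addr0 mxE mul1r -muMj.
under eq_bigr do rewrite M_row.
by rewrite -mulr_suml mu1 mul1r.
Qed.

(** * The law of three equal observations as a bilinear form *)

(** With mu the initial law, phi the emission column of one symbol and M, N the
    transition matrices over two consecutive gaps, this is the probability of
    observing the symbol three times.  Arbitrary matrices are allowed for M and
    N so that transition matrices can be expanded linearly. *)
Definition joint3 (F : pzRingType) (mu phi : 'rV[F]_3) (M N : 'M[F]_3) : F :=
  (mu *m diag_mx phi *m M *m diag_mx phi *m N *m diag_mx phi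
   *m (const_mx 1 : 'cV_3)) 0 0.

Lemma joint3E (F : comNzRingType) (mu phi : 'rV[F]_3) (M N : 'M[F]_3) :
  joint3 mu phi M N =
  \sum_i \sum_j \sum_k mu 0 i * phi 0 i * M i j * phi 0 j * N j k * phi 0 k.
Proof.
rewrite /joint3 mxE.
under eq_bigr => k _.
  rewrite [const_mx _ _ _]mxE mulr1 mul_mx_diag mxE mxE mulr_suml.
  under eq_bigr => j _.
    rewrite mul_mx_diag mxE mxE !mulr_suml.
    under eq_bigr do rewrite mul_mx_diag mxE.
    over.
  rewrite exchange_big /=.
  over.
rewrite exchange_big; apply: eq_bigr => i _ /=; rewrite exchange_big.
by [].
Qed.

Lemma joint3Dl (F : pzRingType) (mu phi : 'rV[F]_3) (M M' N : 'M[F]_3) :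
  joint3 mu phi (M + M') N = joint3 mu phi M N + joint3 mu phi M' N.
Proof. by rewrite /joint3 mulmxDr !mulmxDl mxE. Qed.

Lemma joint3Dr (F : pzRingType) (mu phi : 'rV[F]_3) (M N N' : 'M[F]_3) :
  joint3 mu phi M (N + N') = joint3 mu phi M N + joint3 mu phi M N'.
Proof. by rewrite /joint3 mulmxDr !mulmxDl mxE. Qed.

Lemma joint3Zl (F : comPzRingType) (mu phi : 'rV[F]_3) (a : F) (M N : 'M[F]_3) :
  joint3 mu phi (a *: M) N = a * joint3 mu phi M N.
Proof. by rewrite /joint3 -scalemxAr -!scalemxAl mxE. Qed.

Lemma joint3Zr (F : comPzRingType) (mu phi : 'rV[F]_3) (a : F) (M N : 'M[F]_3) :
  joint3 mu phi M (a *: N) = a * joint3 mu phi M N.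
Proof. by rewrite /joint3 -scalemxAr -!scalemxAl mxE. Qed.

Lemma map_joint3 (F F' : pzRingType) (f : {rmorphism F -> F'})
    (mu phi : 'rV[F]_3) (M N : 'M[F]_3) :
  f (joint3 mu phi M N) =
  joint3 (map_mx f mu) (map_mx f phi) (map_mx f M) (map_mx f N).
Proof.
rewrite /joint3 -map_diag_mx -!map_mxM.
have <- : map_mx f (const_mx 1 : 'cV_3) = const_mx 1.
  by rewrite map_const_mx rmorph1.
by rewrite -map_mxM [RHS]mxE.
Qed.

(** A gap described by the rank-one matrix e mu makes the observations before
    and after it independent, so the form factors, and the two factors do not
    depend on the side on which this gap occurs. *)
Lemma joint3_stationaryC (F : comNzRingType) (mu phi : 'rV[F]_3) (N : 'M[F]_3) :
  joint3 mu phi (const_mx 1 *m mu) N = joint3 mu phi N (const_mx 1 *m mu).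
Proof.
have m11M (X Y : 'M[F]_1) : (X *m Y) 0 0 = X 0 0 * Y 0 0.
  by rewrite mxE big_ord_recl big_ord0 addr0.
rewrite /joint3; set L := diag_mx phi; set e := const_mx 1.
pose s := mu *m L *m e; pose w := mu *m L *m N *m L *m e.
transitivity ((s *m w) 0 0); first by rewrite /s /w !mulmxA.
transitivity ((w *m s) 0 0); last by rewrite /s /w !mulmxA.
by rewrite !m11M mulrC.
Qed.

(** Stationarity at each single state forces the net currents 0 -> 1, 1 -> 2
    and 2 -> 0 to be equal.  With equal currents the remaining sum
    xy(x - y) + yz(y - z) + zx(z - x) is the Vandermonde product up to sign. *)
Lemma joint3_generator (F : comNzRingType) (mu phi : 'rV[F]_3) (A : 'M[F]_3) :
  (forall i, \sum_j A i j = 0) -> mu *m A = 0 ->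
  joint3 mu phi 1%:M A - joint3 mu phi A 1%:M =
  - ((mu 0 0 * A 0 1 - mu 0 1 * A 1 0) *
     ((phi 0 0 - phi 0 1) * (phi 0 1 - phi 0 2) * (phi 0 2 - phi 0 0))).
Proof.
move=> row0 muA; set x := phi 0 0; set y := phi 0 1; set z := phi 0 2.
have col0 j : mu 0 0 * A 0 j + mu 0 1 * A 1 j + mu 0 2 * A 2 j = 0.
  have /rowP/(_ j) := muA; by rewrite !mxE sum3E.
transitivity ((mu 0 0 * A 0 1 - mu 0 1 * A 1 0) * (x * y * (x - y)) +
              (mu 0 1 * A 1 2 - mu 0 2 * A 2 1) * (y * z * (y - z)) +
              (mu 0 2 * A 2 0 - mu 0 0 * A 0 2) * (z * x * (z - x))).
  rewrite !joint3E !sum3E !mxE /= !mulr0n !mulr1n -/x -/y -/z.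
  by ring.
have flux12 : mu 0 1 * A 1 2 - mu 0 2 * A 2 1 = mu 0 0 * A 0 1 - mu 0 1 * A 1 0.
  have := col0 1; have := row0 1; rewrite sum3E.
  move=> /(congr1 (fun u => mu 0 1 * u)) r1 c1.
  apply/eqP; rewrite -subr_eq0; apply/eqP.
  transitivity (mu 0 1 * (A 1 0 + A 1 1 + A 1 2) -
    (mu 0 0 * A 0 1 + mu 0 1 * A 1 1 + mu 0 2 * A 2 1)); first by ring.
  by rewrite r1 c1 mulr0 subr0.
have flux20 : mu 0 2 * A 2 0 - mu 0 0 * A 0 2 = mu 0 0 * A 0 1 - mu 0 1 * A 1 0.
  have := col0 0; have := row0 0; rewrite sum3E.
  move=> /(congr1 (fun u => mu 0 0 * u)) r1 c1.
  apply/eqP; rewrite -subr_eq0; apply/eqP.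
  transitivity ((mu 0 0 * A 0 0 + mu 0 1 * A 1 0 + mu 0 2 * A 2 0) -
    mu 0 0 * (A 0 0 + A 0 1 + A 0 2)); first by ring.
  by rewrite r1 c1 mulr0 subr0.
by rewrite flux12 flux20; ring.
Qed.

(** The antisymmetrised form vanishes on pairs containing E and on equal
    arguments; after writing E + a (1 - E) as (1 - a) E + a, only the pair
    (1, A) is left, with the determinant of the coefficients. *)
Lemma joint3_asym (F : comNzRingType) (mu phi : 'rV[F]_3) (A : 'M[F]_3)
    (a b c d : F) :
  (forall i, \sum_j A i j = 0) -> mu *m A = 0 ->
  let E : 'M[F]_3 := const_mx 1 *m mu in
  let M := E + a *: (1%:M - E) + b *: A in
  let N := E + c *: (1%:M - E) + d *: A in
  joint3 mu phi M N - joint3 mu phi N M =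
  (b * c - a * d) *
  ((mu 0 0 * A 0 1 - mu 0 1 * A 1 0) *
   ((phi 0 0 - phi 0 1) * (phi 0 1 - phi 0 2) * (phi 0 2 - phi 0 0))).
Proof.
move=> row0 muA E M N.
have -> : M = (1 - a) *: E + a *: 1%:M + b *: A.
  by rewrite /M scalerBr scalerBl scale1r addrA addrAC.
have -> : N = (1 - c) *: E + c *: 1%:M + d *: A.
  by rewrite /N scalerBr scalerBl scale1r addrA addrAC.
rewrite !(joint3Dl, joint3Dr, joint3Zl, joint3Zr) !joint3_stationaryC -/E.
have gen := joint3_generator phi row0 muA.
transitivity ((b * c - a * d) *
  - (joint3 mu phi 1%:M A - joint3 mu phi A 1%:M)); first by ring.
by rewrite gen opprK.
Qed.

(** * The flow of a generator with a quadratic relation *)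

Section linear_flow.
Variables (R : realType) (n : nat) (A E : 'M[R[i]]_n.+1).
Variable (X : R -> 'M[R[i]]_n.+1).
Hypothesis X_deriv :
  forall t i j, is_cderive (fun s => X s i j) t ((A *m X t) i j).
Hypothesis X0 : X 0 = 1%:M.
Hypothesis EX : forall t, E *m X t = E.

(** The matrix Y = (A + l2) X - l2 E satisfies Y' = - l1 Y, because
    (A + l1) (A + l2) = l1 l2 E and E X = E. *)
Lemma flow_eigencomponent (l1 l2 : R[i]) (t : R) :
  A *m A + (l1 + l2) *: A + (l1 * l2)%:M = (l1 * l2) *: E ->
  A *m X t + l2 *: X t =
  l2 *: E + expC (- l1 * t%:C) *: (A + l2 *: (1%:M - E)).
Proof.
move=> AE; pose B := A + l2%:M.
have BX s : A *m X s + l2 *: X s = B *m X s.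
  by rewrite mulmxDl mul_scalar_mx.
have BA s : B *m (A *m X s) = - l1 *: (B *m X s - l2 *: E).
  rewrite mulmxA (_ : B *m A = (l1 * l2) *: E - l1 *: B).
    rewrite mulmxBl -!scalemxAl EX scalerBr scalerA mulNr scaleNr.
    by rewrite addrC scaleNr opprK.
  rewrite -AE /B mulmxDl mul_scalar_mx scalerDl scalerDr.
  rewrite scale_scalar_mx opprD addrA [RHS]addrAC addrK.
  by rewrite -!addrA [X in _ + (_ + X)]addrC addNKr.
apply/matrixP => i j; rewrite BX.
pose h s := (B *m X s) i j + (- (l2 *: E)) i j.
have hd s : is_cderive h s (- l1 * h s).
  have -> : - l1 * h s = (B *m (A *m X s)) i j + 0.
    by rewrite BA addr0 mxE; congr (_ * _); rewrite mxE.
  apply: is_cderiveD; last exact: is_cderive_cst.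
  rewrite mxE; under eq_fun do rewrite mxE.
  by apply: is_cderive_sum => k; apply: is_cderiveZ.
have -> : (B *m X t) i j = (l2 *: E) i j + h t.
  rewrite /h (_ : (- (l2 *: E)) i j = - (l2 *: E) i j) ?mxE//.
  by rewrite addrCA subrr addr0.
rewrite (linear_ode t hd) [RHS]mxE; congr (_ + _).
rewrite [RHS]mxE mulrC; congr (_ * _).
rewrite /h X0 mulmx1 /B scalerBr scalemx1 addrA.
by rewrite [RHS]mxE.
Qed.

(** For distinct l1 and l2, subtracting the two eigencomponents leaves a nonzero
    multiple of X.  For l1 = l2 they coincide, and A X + l1 X = X' + l1 X turns
    the eigencomponent into a first-order equation for X - E with resonant
    right-hand side, hence the factor t next to the exponential. *)
Lemma flow_decomposition (l1 l2 : R[i]) :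
  A *m A + (l1 + l2) *: A + (l1 * l2)%:M = (l1 * l2) *: E ->
  exists a b : R -> R[i],
    (forall t, X t = E + a t *: (1%:M - E) + b t *: A) /\
    (forall r t, b r * a t - a r * b t = exp_quotient l1 l2 r t).
Proof.
move=> AE; rewrite /exp_quotient; have [l12|l12] := eqVneq l1 l2; last first.
  have l12_neq0 : l1 - l2 != 0 by rewrite subr_eq0.
  pose e1 t := expC (- l1 * t%:C); pose e2 t := expC (- l2 * t%:C).
  exists (fun t => (l1 * e2 t - l2 * e1 t) / (l1 - l2)).
  exists (fun t => (e2 t - e1 t) / (l1 - l2)); split=> [t|r t].
    have half1 := flow_eigencomponent t AE.
    have half2 : A *m X t + l1 *: X t =
        l1 *: E + expC (- l2 * t%:C) *: (A + l1 *: (1%:M - E)).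
      by apply: flow_eigencomponent; rewrite [l2 + l1]addrC [l2 * l1]mulrC.
    apply: (scalerI l12_neq0); apply/matrixP => i j.
    move: half1 half2; rewrite -/(e1 t) -/(e2 t); set U := A *m X t.
    move=> /matrixP/(_ i j) + /matrixP/(_ i j); clearbody U.
    rewrite !mxE => half1 half2.
    transitivity ((U i j + l1 * X t i j) - (U i j + l2 * X t i j)).
      by ring.
    by rewrite half1 half2; field.
  have expE (u v : R) k l : expC (- k * u%:C - l * v%:C) =
      expC (- k * u%:C) * expC (- l * v%:C) by rewrite expCD !mulNr.
  rewrite !expE -/(e1 r) -/(e1 t) -/(e2 r) -/(e2 t).
  by field.
subst l2; pose e t := expC (- l1 * t%:C).
exists (fun t => e t * (1 + l1 * t%:C)), (fun t => e t * t%:C).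
split=> [t|r t].
  (* Subtracting E and the resonant term from X leaves a solution of the
     homogeneous equation. *)
  pose N := A + l1 *: (1%:M - E); apply/matrixP => i j.
  pose h s := X s i j + (- E i j + - N i j * (s%:C * e s)).
  have hd s : is_cderive h s (- l1 * h s).
    have half := flow_eigencomponent s AE; rewrite -/(e s) -/N in half.
    apply: is_cderive_eq.
      apply: is_cderiveD; first exact: X_deriv.
      apply: is_cderiveD; first exact: is_cderive_cst.
      apply: is_cderiveZ; apply: is_cderiveM; last exact: is_cderive_expC.
      by apply: is_cderive_real; exact: is_derive_id.
    rewrite -/(e s) /h; move: half; set U := A *m X s.
    move=> /matrixP/(_ i j); clearbody U N.
    rewrite !mxE => half.
    transitivity ((U i j + l1 * X s i j) - l1 * X s i j +
      (0 + - N i j * (1 * e s + s%:C * (- l1 * e s)))); first by ring.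
    by rewrite half; ring.
  have := linear_ode t hd; rewrite -/(e t) /h mul0r mulr0 addr0 X0 => hE.
  transitivity (E i j + (X t i j + (- E i j + - N i j * (t%:C * e t))) +
                t%:C * e t * N i j); first by ring.
  by rewrite hE !mxE; ring.
have -> : expC (- l1 * (r + t)%:C) = e r * e t.
  by rewrite -expCD; congr expC; rewrite rmorphD mulrDr.
by rewrite rmorphB /=; ring.
Qed.
End linear_flow.

(** * Finite-dimensional laws of the model *)

Lemma measure_partition (R : realType) (d : measure_display)
    (T : measurableType d) (P : {measure set T -> \bar R}) (I : finType)
    (f : T -> I) (A : set T) :
  measurable A -> (forall i, measurable [set w | f w = i]) ->
  P A = (\sum_i P (A `&` [set w | f w = i]))%E.
Proof.
move=> mA mf; rewrite [in LHS](_ : A =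
    \bigcup_(i in [set: I]) (A `&` [set w | f w = i])); last first.
  by apply/seteqP; split=> w => [Aw|[i _ []//]]; exists (f w).
rewrite measure_fin_bigcup.
- rewrite (fsbigE (index_enum I)) ?index_enum_uniq//.
    by apply: eq_bigl => i; rewrite in_setT.
  by move=> i _; rewrite mem_index_enum.
- exact: finite_finset.
- apply/trivIsetP => i j _ _ ij; apply/seteqP; split=> // w /= [[_ fi] [_ fj]].
  by rewrite -fi -fj eqxx in ij.
- by move=> i _; exact: measurableI.
Qed.

Section hmm_law.
Variables (R : realType) (d : measure_display) (T : measurableType d).
Variables (P : probability T R) (K : nat).
Variables (C : R -> T -> 'I_3) (S : R -> T -> 'I_K).
Variables (Q : 'M[R]_3) (mu : 'rV[R]_3) (Pi : 'M[R]_(3, K)).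
Hypothesis hmm : hidden_markov_model P C S Q mu Pi.

Lemma historyS (tau : nat -> R) (x : nat -> 'I_3) (s : nat -> 'I_K) (n : nat) :
  history C S tau x s n.+1 =
  history C S tau x s n `&` [set w | C (tau n) w = x n /\ S (tau n) w = s n].
Proof.
apply/seteqP; split=> w => [H|[H Hn] k].
  by split=> [k kn|]; apply: H => //; exact: ltnW.
by rewrite ltnS leq_eqVlt => /orP[/eqP->//|]; exact: H.
Qed.

(** Each further time contributes one transition factor, by the Markov
    property, and one emission factor. *)
Lemma history_law (tau : nat -> R) (x : nat -> 'I_3) (s : nat -> 'I_K)
    (n : nat) :
  times_upto tau n -> tau 0%N = 0 ->
  P (history C S tau x s n.+1) =
  (mu 0 (x 0%N) * Pi (x 0%N) (s 0%N) *
   \prod_(k < n) (transition Q (tau k.+1 - tau k) (x k) (x k.+1) *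
                  Pi (x k.+1) (s k.+1)))%:E.
Proof.
move=> tau_times tau0; elim: n tau_times => [|n IHn] tau_times.
  rewrite historyS (hmm_emission hmm)// big_ord0 mulr1.
  rewrite (_ : history _ _ _ _ _ 0 = setT); last exact/seteqP.
  by rewrite setTI tau0 (hmm_initial hmm).
rewrite historyS (hmm_emission hmm)// (hmm_markov hmm)// IHn; last first.
  by case: tau_times => ? lt_tau; split=> // k /ltnW; exact: lt_tau.
by rewrite big_ord_recr /= -!EFinM !mulrA.
Qed.

Lemma observed_law3 (i : 'I_K) (r t : R) : 0 < r -> 0 < t ->
  fine (P [set w | [/\ S 0 w = i, S r w = i & S (r + t) w = i]]) =
  joint3 mu (\row_j Pi j i) (transition Q r) (transition Q t).
Proof.
move=> r0 t0; have rt0 : 0 < r + t by exact: addr_gt0.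
set A := [set w | _].
have mS s : 0 <= s -> measurable [set w | S s w = i].
  by move=> ?; exact: (hmm_measurable_observed hmm).
have mC s j : 0 <= s -> measurable [set w | C s w = j].
  by move=> ?; exact: (hmm_measurable_hidden hmm).
have mA : measurable A.
  rewrite (_ : A = [set w | S 0 w = i] `&` [set w | S r w = i] `&`
                   [set w | S (r + t) w = i]).
    by apply: measurableI; [apply: measurableI|]; apply: mS => //; exact: ltW.
  by apply/seteqP; split=> w => [[]|[[]]].
have mI B s j : measurable B -> 0 <= s ->
    measurable (B `&` [set w | C s w = j]).
  by move=> mB s0; apply: measurableI => //; exact: mC.
have PA : P A = (\sum_a P (A `&` [set w | C 0 w = a]))%E.
  by apply: measure_partition => // j; exact: mC.
have PE a : P (A `&` [set w | C 0 w = a]) = (\sum_b \sum_c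
    (mu 0 a * Pi a i * transition Q r a b * Pi b i *
     transition Q t b c * Pi c i)%:E)%E.
  rewrite (@measure_partition _ _ _ P _ (C r))//; last 2 first.
  - exact: mI.
  - by move=> j; apply: mC; exact: ltW.
  apply: eq_bigr => b _.
  rewrite (@measure_partition _ _ _ P _ (C (r + t)))//; last 2 first.
  - by apply: (mI) (ltW r0); exact: mI.
  - by move=> j; apply: mC; exact: ltW.
  apply: eq_bigr => c _.
  pose tau := nth 0 [:: 0; r; r + t].
  pose x := nth a [:: a; b; c].
  have tau_times : times_upto tau 2.
    by split=> // -[|[|//]] _; rewrite /tau /= ?ltrDl.
  have := history_law x (fun=> i) tau_times erefl.
  rewrite !big_ord_recl big_ord0 mulr1 /= subr0.
  rewrite (_ : r + t - r = t) ?[r + t - r]addrC ?addKr// !mulrA => <-.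
  congr (P _); apply/seteqP; split=> w.
    by move=> [[[[S0 Sr Srt] C0] Cr] Crt] [|[|[|//]]] _; split.
  move=> H; have [C0 S0] := H 0%N isT; have [C1 S1] := H 1%N isT.
  by have [C2 S2] := H 2%N isT.
rewrite PA joint3E.
under eq_bigr do rewrite PE; under eq_bigr do under eq_bigr do rewrite sumEFin.
under eq_bigr do rewrite sumEFin.
rewrite sumEFin /=; do 3![apply: eq_bigr => ? _].
by rewrite !mxE.
Qed.
End hmm_law.

(** * The time-reversal asymmetry *)

Unset Implicit Arguments.
Set Strict Implicit.

Theorem theorem2p4 (R : realType) (d : measure_display) (T : measurableType d)
    (P : probability T R) (K : nat)
    (C : R -> T -> 'I_3) (S : R -> T -> 'I_K)
    (Q : 'M[R]_3) (mu : 'rV[R]_3) (Pi : 'M[R]_(3, K)) (l1 l2 : R[i])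
    (hmm : hidden_markov_model P C S Q mu Pi)
    (eigen : nonzero_eigenvalues Q l1 l2)
    (i : 'I_K) (r t : R) (r_gt0 : 0 < r) (t_gt0 : 0 < t) :
  let x := Pi 0 i in let y := Pi 1 i in let z := Pi 2 i in
  let D := (x - y) * (y - z) * (z - x) in
  (fine (P [set w | [/\ S 0 w = i, S r w = i & S (r + t) w = i]]) -
   fine (P [set w | [/\ S 0 w = i, S t w = i & S (t + r) w = i]]))%:C =
  (flux Q mu * D)%:C * exp_quotient l1 l2 r t.
Proof.
move=> x y z D.
rewrite (observed_law3 hmm)// (observed_law3 hmm)//.
have [_ Q_row0] := hmm_rate hmm.
have [_ mu_sum1 mu_inv] := hmm_stationary hmm.
have muQ : mu *m Q = 0 := stationary_generator mu_inv.
have [_ _ charQ] := eigen.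
pose A := map_mx (real_complex R) Q; pose m := map_mx (real_complex R) mu.
pose phi := map_mx (real_complex R) (\row_j Pi j i).
pose X s := map_mx (real_complex R) (transition Q s).
pose E : 'M[R[i]]_3 := const_mx 1 *m m.
have A_row0 j : \sum_k A j k = 0.
  by under eq_bigr do rewrite mxE; rewrite -rmorph_sum Q_row0.
have m_sum1 : \sum_j m 0 j = 1.
  by under eq_bigr do rewrite mxE; rewrite -rmorph_sum mu_sum1.
have mA : m *m A = 0 by rewrite -map_mxM muQ map_mx0.
have AE : A *m A + (l1 + l2) *: A + (l1 * l2)%:M = (l1 * l2) *: E.
  have [-> ->] := eigenvalues_sum_prod charQ.
  by rewrite scaleNr; exact: stationary_projection.
have X_deriv s j k : is_cderive (fun u => X u j k) s ((A *m X s) j k).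
  rewrite -map_mxM mxE; under eq_fun do rewrite mxE.
  by apply: is_cderive_real; exact: is_derive_expmx.
have X0 : X 0 = 1%:M by rewrite /X /transition expmx0 map_mx1.
have EX s : E *m X s = E.
  by rewrite -mulmxA -map_mxM (stationary_expmx _ muQ).
have [a [b [XE abE]]] := flow_decomposition X_deriv X0 EX AE.
rewrite rmorphB /= !(map_joint3 (real_complex R)) -/m -/phi -/(X r) -/(X t).
rewrite !XE joint3_asym// abE mulrC; congr (_ * _).
by rewrite /A /m /phi /flux /D !mxE !rmorphM !rmorphB !rmorphM.
Qed.
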